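(* Let $\lambda=(0,0,0,0,\lambda_5,\lambda_6,\lambda_6,-\lambda_6)$ be a highest weight (for $\mathfrak{e}_6$) with $\lambda_5\neq 0$. (1) If $3\lambda_6-\lambda_5>14$, then $\lambda$ satisfies the strict Dirac inequality $\|(\lambda-s_{a,b})^{+}+\rho\|^2>\|\lambda+\rho\|^2$ for all $a,b\in\mathbb{N}_0$ with $a+b\neq 0$. (2) If $8<3\lambda_6-\lambda_5<14$, then $\|(\lambda-s_2)^{+}+\rho\|^2<\|\lambda+\rho\|^2$, and the strict Dirac inequality $\|(\lambda-s)^{+}+\rho\|^2>\|\lambda+\rho\|^2$ holds for any Schmid module $s$ of strictly lower level than $s_2$. (3) If $3\lambda_6-\lambda_5<8$, then the basic Dirac inequality fails, i.e. $\|(\lambda-s_1)^{+}+\rho\|^2<\|\lambda+\rho\|^2$.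
   Context: Setting for $\mathfrak{e}_6$ (Hermitian case). Work in $\mathbb{R}^8$ with the standard inner product $\langle\cdot,\cdot\rangle$ and norm $\|\cdot\|$, and let $\mathbb{N}_0=\{0,1,2,\dots\}$. Put $\rho=(0,1,2,3,4,-4,-4,4)$. The group $W_{\mathfrak{k}}$ is generated by the reflections $s_\alpha(\mu)=\mu-\frac{2\langle\mu,\alpha\rangle}{\langle\alpha,\alpha\rangle}\alpha$ for $\alpha=\varepsilon_i\pm\varepsilon_j$, $5\ge i>j\ge 1$, where $\varepsilon_i$ is the $i$-th coordinate functional, identified with the $i$-th standard basis vector; so $W_{\mathfrak{k}}$ permutes the first five coordinates and changes an even number of their signs. For $\mu\in\mathbb{R}^8$, $\mu^{+}$ denotes the unique $W_{\mathfrak{k}}$-conjugate of $\mu$ satisfying $|\mu_1|\le\mu_2\le\mu_3\le\mu_4\le\mu_5$. A highest weight is a real vector $\lambda=(\lambda_1,\lambda_2,\lambda_3,\lambda_4,\lambda_5,\lambda_6,\lambda_6,-\lambda_6)$ with $|\lambda_1|\le\lambda_2\le\lambda_3\le\lambda_4\le\lambda_5$ and $\lambda_i-\lambda_j\in\mathbb{Z}$, $2\lambda_i\in\mathbb{Z}$ for $i,j\in\{1,\dots,5\}$. The basic Schmid modules are (represented by) $s_1=\frac12(1,1,1,1,1,-1,-1,1)$ and $s_2=(0,0,0,0,1,-1,-1,1)$. A general Schmid module is $s_{a,b}=a s_1+b s_2$ with $a,b\in\mathbb{N}_0$, $a+b>0$; its level is $a+2b$. The Dirac inequality for a Schmid module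 $s$ is $\|(\lambda-s)^{+}+\rho\|^2\ge\|\lambda+\rho\|^2$; it is called strict if $>$ holds, and it is called the basic Dirac inequality when $s=s_1$. *)

(* Defs.v *)
From HB Require Import structures.
From mathcomp Require Import all_boot all_order all_algebra.
From mathcomp Require Import boolp classical_sets reals.

Set Implicit Arguments.
Unset Strict Implicit.
Unset Printing Implicit Defensive.

Import Order.TTheory GRing.Theory Num.Theory.

Local Open Scope ring_scope.

Section E6.
Variable R : realType.
Implicit Types mu nu alpha lambda : 'rV[R]_8.

(** Coordinates are numbered 1, ..., 8: [coord mu k] is mu_k and [eps k] the
    k-th standard basis vector. Only 1 <= k <= 8 is meaningful. *)
Definition coord mu (k : nat) : R := mu ord0 (inord k.-1).
Definition eps (k : nat) : 'rV[R]_8 := delta_mx ord0 (inord k.-1).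

(** [vec8 [:: x1; ...; x8]] is (x1, ..., x8). *)
Definition vec8 (s : seq R) : 'rV[R]_8 := \row_(i < 8) s`_i.

Definition dot mu nu : R := \sum_(i < 8) mu ord0 i * nu ord0 i.
Definition enorm mu : R := Num.sqrt (dot mu mu).

Definition rho : 'rV[R]_8 := vec8 [:: 0; 1; 2; 3; 4; - 4; - 4; 4].

Definition reflection alpha mu : 'rV[R]_8 :=
  mu - (2 * dot mu alpha / dot alpha alpha) *: alpha.

Definition is_kroot alpha : Prop :=
  exists i j : nat, [/\ (1 <= j)%N, (j < i)%N, (i <= 5)%N &
    alpha = eps i + eps j \/ alpha = eps i - eps j].

(** No inverse constructor is needed: the generators are involutions. *)
Inductive in_Wk : ('rV[R]_8 -> 'rV[R]_8) -> Prop :=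
| Wk_id : in_Wk id
| Wk_refl alpha : is_kroot alpha -> in_Wk (reflection alpha)
| Wk_comp v w : in_Wk v -> in_Wk w -> in_Wk (v \o w).

Definition Wk_conj mu nu : Prop := exists2 w, in_Wk w & nu = w mu.

Definition kdominant mu : Prop :=
  [/\ `|coord mu 1| <= coord mu 2, coord mu 2 <= coord mu 3,
      coord mu 3 <= coord mu 4 & coord mu 4 <= coord mu 5].

(** The default value [mu] of [xget] is never used, since every W_k-orbit
    contains exactly one [kdominant] vector. *)
Definition plus mu : 'rV[R]_8 :=
  xget mu [set nu | Wk_conj mu nu /\ kdominant nu]%classic.

Definition highest_weight lambda : Prop :=
  [/\ coord lambda 7 = coord lambda 6,
      coord lambda 8 = - coord lambda 6,
      kdominant lambda,
      (forall i j : nat, (1 <= i <= 5)%N -> (1 <= j <= 5)%N ->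
         coord lambda i - coord lambda j \is a Num.int) &
      (forall i : nat, (1 <= i <= 5)%N -> 2 * coord lambda i \is a Num.int)].

Definition s1 : 'rV[R]_8 := 2^-1 *: vec8 [:: 1; 1; 1; 1; 1; - 1; - 1; 1].
Definition s2 : 'rV[R]_8 := vec8 [:: 0; 0; 0; 0; 1; - 1; - 1; 1].

(** A Schmid module is a pair (a, b) of naturals with [(0 < a + b)%N]; it is
    represented by the vector [schmid a b]. In particular, s1 is (1, 0) and s2
    is (0, 1). *)
Definition schmid (a b : nat) : 'rV[R]_8 := s1 *+ a + s2 *+ b.

End E6.

Definition level (a b : nat) : nat := (a + 2 * b)%N.

Arguments rho {R}.
Arguments s1 {R}.
Arguments s2 {R}.

(* Main.v *)
(** Only the norm of [plus (lambda - s)] and its pairing with [rho] matter, and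
    since rho_1 = 0 both depend only on the absolute values of the first five
    coordinates, which W_k permutes. For s = s_{a,b} put t = a/2 + b,
    c = l5 - t and X = 3 l6 - l5; the sorted absolute values are
    (a/2, a/2, a/2, a/2, |c|) or (|c|, a/2, a/2, a/2, a/2), and
      ||(lambda - s)^+ + rho||^2 - ||lambda + rho||^2
        >= a^2 + 4 t^2 + 2 t X + 6 a - 32 t,
    with equality when c >= a/2. The right-hand side is X - 8 for s_1 and
    2 (X - 14) for s_2; both are equality cases because l5 >= 1. *)
Require Import Defs.
From HB Require Import structures.
From mathcomp Require Import all_boot all_order all_algebra.
From mathcomp Require Import boolp classical_sets reals.
From mathcomp Require Import perm zify ring lra.

Import Order.TTheory GRing.Theory Num.Theory.

Local Open Scope ring_scope.

(* [mathcomp.algebra.vector] shadows [coord]. *)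
Local Notation coord := Defs.coord.

Section Weyl.
Variable R : realType.
Implicit Types (mu nu : 'rV[R]_8) (s : seq R) (x : R).

(** * Action of W_k on coordinates and their absolute values *)

Lemma dot_delta mu (k : 'I_8) : dot mu (delta_mx ord0 k) = mu ord0 k.
Proof.
rewrite /dot (bigD1 k) //= mxE !eqxx mulr1 big1 ?addr0 // => l /negPf lk.
by rewrite mxE lk andbF mulr0.
Qed.

Lemma dot_addZr mu nu nu' x : dot mu (nu + x *: nu') = dot mu nu + x * dot mu nu'.
Proof.
rewrite /dot mulr_sumr -big_split /=; apply: eq_bigr => k _.
by rewrite !mxE; ring.
Qed.

(** The root has squared length 1 + x^2 = 2, so the reflection subtracts (mu_i + x mu_j) times it;
    the sign x treats both root types at once. *)
Lemma reflection_coord (i j k : 'I_8) x mu : i != j -> x ^+ 2 = 1 ->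
  reflection (delta_mx ord0 i + x *: delta_mx ord0 j) mu ord0 k =
  if k == i then - x * mu ord0 j else
  if k == j then - x * mu ord0 i else mu ord0 k.
Proof.
move=> ij x2; set alpha := _ + _ *: _.
have aE l : alpha ord0 l = (l == i)%:R + x * (l == j)%:R by rewrite !mxE !eqxx.
have dE nu : dot nu alpha = nu ord0 i + x * nu ord0 j.
  by rewrite dot_addZr !dot_delta.
clearbody alpha; rewrite /reflection !dE !aE !eqxx (eq_sym j) (negPf ij).
rewrite (_ : 1%:R + x * 0%:R + x * (0%:R + x * 1%:R) = 2); last by ring: x2.
rewrite mulrAC divff ?mul1r ?pnatr_eq0 //.
rewrite !mxE aE; case: (eqVneq k i) => [->|ki].
  by rewrite (negPf ij) /=; ring.
by case: (eqVneq k j) => [->|kj] /=; ring: x2.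
Qed.

Lemma kroot_sign (alpha : 'rV[R]_8) : is_kroot alpha ->
  exists (i j : 'I_8) x, [/\ i != j, (i < 5)%N, (j < 5)%N, x ^+ 2 = 1 &
    alpha = delta_mx ord0 i + x *: delta_mx ord0 j].
Proof.
move=> [i [j [j0 ji i5 E]]].
have [i0 Ei Ej] : [/\ (0 < i)%N, (inord i.-1 : 'I_8) = i.-1 :> nat
    & (inord j.-1 : 'I_8) = j.-1 :> nat].
  by split; [lia|rewrite inordK //; lia..].
have ij : (inord i.-1 : 'I_8) != inord j.-1 by rewrite -val_eqE /= Ei Ej; lia.
exists (inord i.-1), (inord j.-1), (if `[< alpha = eps R i + eps R j >] then 1 else -1).
split=> //; [by rewrite Ei; lia|by rewrite Ej; lia| |].
  by case: ifP => _; ring.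
case: ifPn => [/asboolP->|/asboolPn nE]; first by rewrite scale1r.
by case: E => // ->; rewrite scaleN1r.
Qed.

(** Induction on the generation of W_k: a generating reflection transposes two of the first five
    coordinates up to sign. Indices start at 0, so [4 < k] selects coordinates 6, 7, 8. *)
Lemma Wk_abs (w : 'rV[R]_8 -> 'rV[R]_8) : in_Wk w -> forall mu,
  exists s : {perm 'I_8}, forall k : 'I_8,
    `|w mu ord0 k| = `|mu ord0 (s k)| /\
    ((4 < k)%N -> s k = k /\ w mu ord0 k = mu ord0 k).
Proof.
elim=> {w} [mu|alpha /kroot_sign[i [j [x [ij i5 j5 x2 ->]]]] mu|v w _ IHv _ IHw mu].
- by exists 1%g => k; rewrite perm1.
- have x1 : `|x| = 1.
    by apply/eqP; rewrite -sqrp_eq1 // -normrX x2 normr1.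
  exists (tperm i j) => k; rewrite reflection_coord //; split.
    case: tpermP => [->|->|/eqP/negPf-> /eqP/negPf->] //.
      by rewrite eqxx normrM normrN x1 mul1r.
    by rewrite eq_sym (negPf ij) eqxx normrM normrN x1 mul1r.
  move=> k4; have ki : k != i by apply: contraTneq k4 => ->; lia.
  have kj : k != j by apply: contraTneq k4 => ->; lia.
  by rewrite (negPf ki) (negPf kj) tpermD // eq_sym.
- have [s Hs] := IHw mu; have [s' Hs'] := IHv (w mu).
  exists (s' * s)%g => k; rewrite permM /=; split.
    by rewrite (Hs' k).1 (Hs _).1.
  by move=> k4; have [-> ->] := (Hs' k).2 k4; apply: (Hs k).2.
Qed.

Lemma eq_coord mu (k : 'I_8) : mu ord0 k = coord mu k.+1.
Proof. by rewrite /coord inord_val. Qed.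

Lemma coord_vec8 s k : (0 < k <= 8)%N -> coord (vec8 s) k = s`_k.-1.
Proof. by move=> k8; rewrite /coord mxE inordK //; lia. Qed.

Lemma Wk_conj_abs mu nu : Wk_conj mu nu ->
  [/\ perm_eq [seq `|coord nu k| | k <- iota 1 5] [seq `|coord mu k| | k <- iota 1 5],
      coord nu 6 = coord mu 6, coord nu 7 = coord mu 7 & coord nu 8 = coord mu 8].
Proof.
move=> [w /Wk_abs/(_ mu)[s Hs] ->].
have E k : (5 < k <= 8)%N -> coord (w mu) k = coord mu k.
  by move=> k8; apply: ((Hs _).2 _).2; rewrite inordK; lia.
split; [|exact: E..].
have E8 (m : 'rV[R]_8) : [seq `|m ord0 k| | k <- enum 'I_8] =
    [seq `|coord m k| | k <- iota 1 5]
    ++ [seq `|coord m k| | k <- iota 6 3] :> seq R.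
  rewrite -map_cat -[_ ++ _]/(iota 1 8) (iotaDl 1 0 8) -val_enum_ord -2!map_comp.
  by apply: eq_map => k /=; rewrite eq_coord.
have: perm_eq [seq `|w mu ord0 k| | k <- enum 'I_8] [seq `|mu ord0 k| | k <- enum 'I_8].
  rewrite (eq_map (fun k => (Hs k).1)) (map_comp (fun k => `|mu ord0 k|)).
  apply/perm_map/uniq_perm.
    by rewrite map_inj_uniq ?enum_uniq //; apply: perm_inj.
    exact: enum_uniq.
  move=> k; rewrite mem_enum; apply/mapP; exists (s^-1%g k).
    by rewrite mem_enum.
  by rewrite permKV.
(* The last three entries agree on both sides; cancelling them restricts the permutation to the
   first five. *)
rewrite !E8; set l := [seq _ | k <- iota 6 3]; set l' := [seq _ | k <- iota 6 3].
by rewrite (_ : l = l') ?perm_cat2r // /l /= !E.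
Qed.

(** * Dominant conjugates of the vectors lambda - s *)

Lemma plusP mu : (exists2 nu, Wk_conj mu nu & kdominant nu) ->
  Wk_conj mu (plus mu) /\ kdominant (plus mu).
Proof.
move=> [nu cn dn]; apply: (xgetPex mu (P := fun nu => Wk_conj mu nu /\ kdominant nu)).
by exists nu.
Qed.

Lemma Wk_conj_trans mu nu nu' : Wk_conj mu nu -> Wk_conj nu nu' -> Wk_conj mu nu'.
Proof.
by move=> [v Wv ->] [w Ww ->]; exists (w \o v) => //; apply: Wk_comp.
Qed.

(** The elementary moves, on zero-based positions: x = -1 swaps two entries, x = 1 swaps and negates
    them. *)
Lemma Wk_conj_refl_vec8 s i j x : (j < i)%N -> (i < 5)%N -> x = 1 \/ x = -1 ->
  Wk_conj (vec8 s)
    (vec8 (set_nth 0 (set_nth 0 s i (- x * s`_j)) j (- x * s`_i))).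
Proof.
move=> ji i5 x1.
exists (reflection (delta_mx ord0 (inord i) + x *: delta_mx ord0 (inord j))).
  apply: Wk_refl; exists i.+1, j.+1; split=> //.
  by case: x1 => ->; [left; rewrite scale1r|right; rewrite scaleN1r].
have [Ei Ej] : (inord i : 'I_8) = i :> nat /\ (inord j : 'I_8) = j :> nat.
  by split; rewrite inordK //; lia.
apply/rowP => k; rewrite reflection_coord; last first.
- by case: x1 => ->; ring.
- by rewrite -val_eqE /= Ei Ej; lia.
rewrite !mxE -!val_eqE /= Ei Ej !nth_set_nth /= nth_set_nth /=.
case: (eqVneq (k : nat) i) => [->|//].
by case: eqVneq => [E|//]; move: ji; rewrite E ltnn.
Qed.

(** Two double sign changes make the four entries -h positive. If c < h, then c is swapped to the
    front; if moreover c < -h, one more double sign change brings it back to the end as -c. *)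
Lemma dominant_conj (h c d6 d7 d8 : R) : 0 <= h ->
  exists2 nu, Wk_conj (vec8 [:: - h; - h; - h; - h; c; d6; d7; d8]) nu
    & kdominant nu.
Proof.
move=> h0.
have step s s' nu i j x : (j < i)%N -> (i < 5)%N -> x = 1 \/ x = -1 ->
    s' = set_nth 0 (set_nth 0 s i (- x * s`_j)) j (- x * s`_i) ->
    Wk_conj (vec8 s') nu -> Wk_conj (vec8 s) nu.
  by move=> ji i5 x1 ->; apply/Wk_conj_trans/Wk_conj_refl_vec8.
have id_conj nu : Wk_conj nu nu by exists id => //; apply: Wk_id.
have pos nu : Wk_conj (vec8 [:: h; h; h; h; c; d6; d7; d8]) nu ->
    Wk_conj (vec8 [:: - h; - h; - h; - h; c; d6; d7; d8]) nu.
  move=> H; apply: (step _ [:: h; h; - h; - h; c; d6; d7; d8] _ 1%N 0%N 1) => //.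
  - by left.
  - by rewrite /= !mulN1r !opprK.
  apply: (step _ [:: h; h; h; h; c; d6; d7; d8] _ 3%N 2%N 1) => //.
  - by left.
  - by rewrite /= !mulN1r !opprK.
have [hc|ch] := lerP h c.
  exists (vec8 [:: h; h; h; h; c; d6; d7; d8]); first exact/pos/id_conj.
  by split; rewrite !coord_vec8 //= ger0_norm.
have swap nu : Wk_conj (vec8 [:: c; h; h; h; h; d6; d7; d8]) nu ->
    Wk_conj (vec8 [:: h; h; h; h; c; d6; d7; d8]) nu.
  apply: (step _ _ _ 4%N 0%N (-1)) => //; first by right.
  by rewrite /= opprK !mul1r.
have [hc|ch'] := lerP (- h) c.
  exists (vec8 [:: c; h; h; h; h; d6; d7; d8]); first exact/pos/swap/id_conj.
  by split; rewrite !coord_vec8 //= ler_norml hc ltW.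
exists (vec8 [:: - h; h; h; h; - c; d6; d7; d8]).
  apply/pos/swap.
  apply: (step _ [:: - h; h; h; h; - c; d6; d7; d8] _ 4%N 0%N 1) => //.
  - by left.
  - by rewrite /= !mulN1r.
by split; rewrite !coord_vec8 //= ?normrN ?ger0_norm //; lra.
Qed.

Lemma kdominant_sorted mu : kdominant mu ->
  [seq `|coord mu k| | k <- iota 1 5] =
    [:: `|coord mu 1|; coord mu 2; coord mu 3; coord mu 4; coord mu 5] /\
  sorted <=%R [seq `|coord mu k| | k <- iota 1 5].
Proof.
move=> [m1 m2 m3 m4].
have p2 := le_trans (normr_ge0 _) m1; have p3 := le_trans p2 m2.
have p4 := le_trans p3 m3; have p5 := le_trans p4 m4.
by rewrite /= (ger0_norm p2) (ger0_norm p3) (ger0_norm p4) (ger0_norm p5) m1 m2 m3 m4.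
Qed.

(** The absolute values of the first five coordinates of a dominant vector are sorted, and W_k
    preserves their multiset; sorted lists that are permutations of each other coincide. *)
Lemma plus_coords (h c d6 d7 d8 : R) : 0 <= h ->
  let nu := plus (vec8 [:: - h; - h; - h; - h; c; d6; d7; d8]) in
  [:: `|coord nu 1|; coord nu 2; coord nu 3; coord nu 4; coord nu 5] =
    (if h <= `|c| then [:: h; h; h; h; `|c|] else [:: `|c|; h; h; h; h]) /\
  [/\ coord nu 6 = d6, coord nu 7 = d7 & coord nu 8 = d8].
Proof.
move=> h0 /=; set mu := vec8 _.
have [/Wk_conj_abs[pe e6 e7 e8] dn] := plusP _ (dominant_conj h c d6 d7 d8 h0).
rewrite -/mu in pe e6 e7 e8 dn *.
split; last by rewrite e6 e7 e8 !coord_vec8.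
have [<- so] := kdominant_sorted _ dn.
apply: (sorted_eq le_trans le_anti so).
  by case: lerP => H; rewrite /= !lexx ?H ?(ltW H).
apply: (perm_trans pe); rewrite /= !coord_vec8 //= !normrN ger0_norm //.
by case: ifP => _ //; rewrite -(perm_rot 4).
Qed.

(** * Squared norms after the shift by rho *)

Lemma enorm_sqr mu : enorm mu ^+ 2 = \sum_(i < 8) mu ord0 i ^+ 2.
Proof.
rewrite /enorm sqr_sqrtr /dot; last first.
  by apply: sumr_ge0 => i _; rewrite -expr2 sqr_ge0.
by apply: eq_bigr => i _; rewrite expr2.
Qed.

Lemma enorm_addrho mu : enorm (mu + rho) ^+ 2 =
  coord mu 1 ^+ 2 + (coord mu 2 + 1) ^+ 2 + (coord mu 3 + 2) ^+ 2
  + (coord mu 4 + 3) ^+ 2 + (coord mu 5 + 4) ^+ 2 + (coord mu 6 - 4) ^+ 2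
  + (coord mu 7 - 4) ^+ 2 + (coord mu 8 + 4) ^+ 2.
Proof.
rewrite enorm_sqr !big_ord_recr big_ord0 /=.
by rewrite !mxE !eq_coord /= addr0 add0r.
Qed.

(** Here 78 is the squared norm of rho, and the conditional is the pairing of the sorted absolute
    values with (0, 1, 2, 3, 4). *)
Lemma enorm_plus_addrho (h c d : R) : 0 <= h ->
  enorm (plus (vec8 [:: - h; - h; - h; - h; c; d; d; - d]) + rho) ^+ 2 =
  4 * h ^+ 2 + c ^+ 2 + 3 * d ^+ 2 - 24 * d + 78
  + 2 * (if h <= `|c| then 6 * h + 4 * `|c| else 10 * h).
Proof.
move=> h0; rewrite enorm_addrho.
have [E [-> -> ->]] := plus_coords h c d d (- d) h0.
(* The first coordinate is known only up to sign, so its square is rewritten through its absolute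
   value. *)
move: E; rewrite -(real_normK (num_real (coord _ 1))) -(real_normK (num_real c)).
by case: ifP => _ [-> -> -> -> ->]; ring.
Qed.

Lemma sub_schmid (l5 l6 : R) (a b : nat) :
  vec8 [:: 0; 0; 0; 0; l5; l6; l6; - l6] - schmid R a b =
  let h := a%:R / 2 in let t := h + b%:R in
  vec8 [:: - h; - h; - h; - h; l5 - t; l6 + t; l6 + t; - (l6 + t)].
Proof.
apply/rowP => k; rewrite !mxE !mulmxnE !mxE.
by case: k => -[|[|[|[|[|[|[|[|//]]]]]]]] _ /=; field.
Qed.

(** * Bounds for the Dirac difference *)

Definition dirac_poly (X : R) (a b : nat) : R :=
  let t := a%:R / 2 + b%:R in
  a%:R ^+ 2 + 4 * t ^+ 2 + 2 * t * X + 6 * a%:R - 32 * t.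

Lemma enorm_weight_addrho (l5 l6 : R) :
  enorm (vec8 [:: 0; 0; 0; 0; l5; l6; l6; - l6] + rho) ^+ 2 =
  l5 ^+ 2 + 8 * l5 + 3 * l6 ^+ 2 - 24 * l6 + 78.
Proof. by rewrite enorm_addrho !coord_vec8 //=; ring. Qed.

(** The hypothesis says c >= a/2, where c = l5 - a/2 - b; hence |c| = c and it is the largest
    entry. *)
Lemma dirac_diff_eq (l5 l6 : R) (a b : nat) : a%:R + b%:R <= l5 ->
  let lambda := vec8 [:: 0; 0; 0; 0; l5; l6; l6; - l6] in
  enorm (plus (lambda - schmid R a b) + rho) ^+ 2 =
  enorm (lambda + rho) ^+ 2 + dirac_poly (3 * l6 - l5) a b.
Proof.
move=> abl; have a0 := ler0n R a.
rewrite /= sub_schmid /= enorm_plus_addrho ?divr_ge0 // enorm_weight_addrho.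
rewrite ger0_norm; last by lra.
rewrite /dirac_poly ifT; last by lra.
by field.
Qed.

(** With h = a/2, both branches are at least 6 h + 4 c: the first since |c| >= c, the second since h
    > |c|. *)
Lemma dirac_diff_ge (l5 l6 : R) (a b : nat) :
  let lambda := vec8 [:: 0; 0; 0; 0; l5; l6; l6; - l6] in
  enorm (lambda + rho) ^+ 2 + dirac_poly (3 * l6 - l5) a b <=
  enorm (plus (lambda - schmid R a b) + rho) ^+ 2.
Proof.
have a0 := ler0n R a.
rewrite /= sub_schmid /= enorm_plus_addrho ?divr_ge0 // enorm_weight_addrho.
set c := l5 - _; have := ler_norm c.
rewrite /dirac_poly (_ : l5 = c + (a%:R / 2 + b%:R)); last by rewrite subrK.
by case: ifP => [_|/negbT]; rewrite -?ltNge; nra.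
Qed.

(** The polynomial is strictly increasing in X, as t > 0, and at X = 14 it equals a^2 + 6 a + 4 t (t
    - 1). This is nonnegative: t >= 1 if b > 0, and it is 2 a^2 + 4 a if b = 0. *)
Lemma dirac_poly_gt0 (X : R) (a b : nat) : (a + b)%N <> 0%N -> 14 < X ->
  0 < dirac_poly X a b.
Proof.
move=> ab X14; rewrite /dirac_poly.
have a0 := ler0n R a; have b0 := ler0n R b.
have [t0 t1] : 0 < a%:R / 2 + b%:R :> R /\
    0 <= a%:R ^+ 2 + 6 * a%:R + 4 * (a%:R / 2 + b%:R) * (a%:R / 2 + b%:R - 1) :> R.
  case: b ab b0 => [|b] ab b0.
    have a1 : 1 <= a%:R :> R by rewrite ler1n lt0n; apply/eqP; lia.
    by split; nra.
  have b1 : 1 <= b.+1%:R :> R by rewrite ler1n.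
  by split; nra.
by nra.
Qed.

End Weyl.

Theorem theorem2p2 (R : realType) (l5 l6 : R) (lambda : 'rV[R]_8)
  (lambdaE : lambda = vec8 [:: 0; 0; 0; 0; l5; l6; l6; - l6])
  (hw : highest_weight lambda)
  (l5_neq0 : l5 <> 0) :
  (3 * l6 - l5 > 14 ->
     forall a b : nat, (a + b)%N <> 0%N ->
       enorm (plus (lambda - schmid R a b) + rho) ^+ 2
         > enorm (lambda + rho) ^+ 2)
  /\
  (8 < 3 * l6 - l5 < 14 ->
     enorm (plus (lambda - s2) + rho) ^+ 2 < enorm (lambda + rho) ^+ 2
     /\
     forall a b : nat, (0 < a + b)%N -> (level a b < level 0 1)%N ->
       enorm (plus (lambda - schmid R a b) + rho) ^+ 2
         > enorm (lambda + rho) ^+ 2)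
  /\
  (3 * l6 - l5 < 8 ->
     enorm (plus (lambda - s1) + rho) ^+ 2 < enorm (lambda + rho) ^+ 2).
Proof.
(* Since lambda_4 = 0, integrality of lambda_5 - lambda_4 makes l5 a nonnegative integer, and it is
   nonzero. *)
have l5_ge1 : 1 <= l5.
  move: hw; rewrite lambdaE => -[_ _ [_ _ _ l50] /(_ 5%N 4%N isT isT) l5Z _].
  move: l50 l5Z; rewrite !coord_vec8 //= subr0 => l50 /intrP[z zE].
  move: l50 l5_neq0; rewrite zE ler0z ler1z => z0 zn0.
  by have : z != 0 by [apply/eqP => z00; apply: zn0; rewrite z00]; lia.
have s1E : s1 = schmid R 1 0 by rewrite /schmid mulr0n addr0.
have s2E : s2 = schmid R 0 1 by rewrite /schmid mulr0n add0r.
rewrite lambdaE s1E s2E; set X := 3 * l6 - l5; split; [|split].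
- move=> X14 a b ab; apply: lt_le_trans (dirac_diff_ge _ _ _ _ _).
  by rewrite ltrDl dirac_poly_gt0.
- move=> /andP[X8 X14]; split.
    rewrite dirac_diff_eq ?add0r // gtrDl /dirac_poly -/X; lra.
  move=> a b ab; rewrite /level => lev.
  (* The level of s_2 is 2, so only s_1 lies strictly below it. *)
  have [-> ->] : a = 1%N /\ b = 0%N by split; lia.
  apply: lt_le_trans (dirac_diff_ge _ _ _ _ _).
  by rewrite ltrDl /dirac_poly -/X; lra.
- move=> X8; rewrite dirac_diff_eq ?addr0 // gtrDl /dirac_poly -/X; lra.
Qed.
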